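(* Let $\{B_t : t\ge 0\}$ be an adapted fuzzy set--valued stochastic process on $(\Omega,\mathcal F,\{\mathcal F_t\},\mathbb P)$ with values in $\mathcal F_{kc}(\mathbb R^d)$. Then $\{B_t\}_{t\ge 0}$ is a fuzzy set--valued Brownian motion if and only if there exists a Wiener process $\{b_t : t\ge 0\}$ in $\mathbb R^d$ such that, for every $t\ge 0$, \[ B_t = \mathbf 1_{\{b_t\}} \qquad \mathbb P\text{-a.s.}, \] where $\mathbf 1_{\{a\}}:\mathbb R^d\to\{0,1\}$ is the indicator function of the singleton $\{a\}$.
   Context: $(\Omega,\mathcal F,\mathbb P)$ is a complete probability space with a filtration $\{\mathcal F_t\}_{t\ge0}$ satisfying the usual conditions. A fuzzy set is a map $\nu:\mathbb R^d\to[0,1]$. $\mathcal F_{kc}(\mathbb R^d)$ is the family of fuzzy sets $\nu$ such that: - every level set $\nu_\alpha=\{x:\nu(x)\ge\alpha\}$, $\alpha\in(0,1]$, is closed; - $\nu_1\neq\emptyset$; - the support $\nu_{0+}=\overline{\{x:\nu(x)>0\}}$ is compact; - every $\nu_\alpha$ is convex. Operations are defined levelwise by $(\nu^1\oplus\nu^2)_\alpha=\nu^1_\alpha+\nu^2_\alpha$ (Minkowski sum) and $(\lambda\nu)_\alpha=\lambda\nu_\alpha$. A fuzzy set--valued random variable is a map $X:\Omega\to\mathcal F_{kc}(\mathbb R^d)$ such that each $\omega\mapsto X(\omega)_\alpha$, $\alpha\in(0,1]$, is a random compact convex set, i.e. measurable with respect to the Borel $\sigma$-algebra of the Hausdorff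 metric. The process is adapted if each $B_t$ is $\mathcal F_t$-measurable. Let $S^{d-1}$ be the unit sphere of $\mathbb R^d$ and $C(S^{d-1})$ the continuous functions on it with the sup norm. $\overline{\mathbf C}$ denotes the Banach space of functions $f:[0,1]\to C(S^{d-1})$ that are bounded, left continuous on $(0,1]$, right continuous at $0$, and have right limits on $(0,1)$, with norm $\|f\|=\sup_{\alpha}\|f(\alpha)\|_{C}$. The support function of $\nu\in\mathcal F_{kc}(\mathbb R^d)$ is the element $s_\nu\in\overline{\mathbf C}$ given by $s_\nu(x,\alpha)=\sup\{\langle x,a\rangle : a\in\nu_\alpha\}$ for $\alpha>0$, and by the same formula with $\nu_{0+}$ in place of $\nu_\alpha$ for $\alpha=0$. The map $\nu\mapsto s_\nu$ is an isometric embedding of $\mathcal F_{kc}(\mathbb R^d)$ into $\overline{\mathbf C}$ (with the metric $d_\infty(\nu^1,\nu^2)=\sup_\alpha d_H(\nu^1_\alpha,\nu^2_\alpha)$), is additive and positively homogeneous, and has closed image. A process is a fuzzy set--valued Brownian motion if $\{s_{B_t}\}_{t\ge0}$ is a Brownian motion in $\overline{\mathbf C}$. This means it is a Gaussian process starting at $0$, i.e. $B_0=\mathbf 1_{\{0\}}$, with $\mathbb E[f(s_{B_t})]=0$ for all $t\ge0$ and all $f\in\overline{\mathbf C}^*$, independent increments, and covariances of the form $(t\wedge s)$ times a fixed covariance. Here a process $\{s_{B_t}\}$ is Gaussian if for every $n$ and all $f_1,\dots,f_n\in\overline{\mathbf C}^*$ the real process $\{(f_1(s_{B_t}),\dots,f_n(s_{B_t}))\}_t$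 is Gaussian. A Wiener process in $\mathbb R^d$ is a centered Gaussian process with $b_0=0$ and independent Gaussian increments whose covariance is $(t-s)$ times a fixed covariance matrix. *)

(* Defs.v *)
From HB Require Import structures.
From mathcomp Require Import all_boot all_order all_algebra.
From mathcomp Require Import all_classical all_reals all_analysis.
Set Implicit Arguments. Unset Strict Implicit. Unset Printing Implicit Defensive.
Import Order.TTheory GRing.Theory Num.Theory.
Import numFieldNormedType.Exports.
Local Open Scope classical_set_scope.
Local Open Scope ring_scope.

Section FuzzyDefs.
Variables (R : realType) (d : nat).
Local Notation V := 'rV[R]_d.

Definition dotv (x a : V) : R := \sum_(i < d) x ord0 i * a ord0 i.
Definition enorm (x : V) : R := Num.sqrt (dotv x x).
Definition sphere : set V := [set x | enorm x = 1].

Definition convex_set_Rd (A : set V) : Prop :=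
  forall a b, A a -> A b -> forall l : R, 0 <= l <= 1 ->
    A (l *: a + (1 - l) *: b).

Definition level (nu : V -> R) (al : R) : set V := [set x | al <= nu x].
Definition fsupport (nu : V -> R) : set V := closure [set x | 0 < nu x].

Definition fuzzy_kc (nu : V -> R) : Prop :=
  [/\ (forall x, 0 <= nu x <= 1),
      (forall al, 0 < al <= 1 -> closed (level nu al)),
      level nu 1 !=set0,
      compact (fsupport nu) &
      (forall al, 0 < al <= 1 -> convex_set_Rd (level nu al))].

Definition ind1 (a : V) : V -> R := fun x => if x == a then 1 else 0.

(** support function s_nu(x, alpha), as a map alpha |-> (x |-> s_nu(x,alpha));
    only its values for alpha in [0,1] and x in the unit sphere matter *)
Definition sfun (nu : V -> R) : R -> V -> R := fun al x =>
  sup [set dotv x a | a in (if al == 0 then fsupport nu else level nu al)].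

(** The Banach space \bar C: functions f : [0,1] -> C(S^{d-1}), represented
    as maps R -> V -> R of which only the restriction to [0,1] x S^{d-1}
    matters. *)
Definition in_Cbar (f : R -> V -> R) : Prop :=
  [/\
      (forall al, 0 <= al <= 1 -> {within sphere, continuous (f al)}),
      (exists M : R, forall al x, 0 <= al <= 1 -> sphere x -> `|f al x| <= M),
      (forall al, 0 < al <= 1 -> forall e : R, 0 < e -> exists2 del : R, 0 < del &
         forall be x, 0 <= be <= al -> al - del < be -> sphere x ->
           `|f be x - f al x| <= e),
      (forall e : R, 0 < e -> exists2 del : R, 0 < del &
         forall be x, 0 <= be <= 1 -> be < del -> sphere x ->
           `|f be x - f 0 x| <= e) &
      (forall al, 0 < al < 1 -> exists h : V -> R,
         {within sphere, continuous h} /\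
         forall e : R, 0 < e -> exists2 del : R, 0 < del &
           forall be x, al < be <= 1 -> be < al + del -> sphere x ->
             `|f be x - h x| <= e)].

Definition Cbar_norm (f : R -> V -> R) : R :=
  sup [set `|f p.1 p.2| | p in [set p : R * V | 0 <= p.1 <= 1 /\ sphere p.2]].

(** elements of the dual \bar C^*: bounded linear functionals on \bar C
    (their values outside \bar C are irrelevant) *)
Definition Cbar_dual (L : (R -> V -> R) -> R) : Prop :=
  [/\ (forall f g, in_Cbar f -> in_Cbar g ->
         L (fun al x => f al x + g al x) = L f + L g),
      (forall (c : R) f, in_Cbar f -> L (fun al x => c * f al x) = c * L f) &
      (exists M : R, forall f, in_Cbar f -> `|L f| <= M * Cbar_norm f)].

Definition ptdist (a : V) (B : set V) : R := inf [set enorm (a - b) | b in B].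
Definition hausdorff (A B : set V) : R :=
  Num.max (sup [set ptdist a B | a in A]) (sup [set ptdist b A | b in B]).
Definition Kc : set (set V) := [set K | [/\ K !=set0, compact K & convex_set_Rd K]].
Definition hopen (U : set (set V)) : Prop :=
  U `<=` Kc /\ forall K, U K -> exists2 e : R, 0 < e &
    forall K', Kc K' -> hausdorff K K' < e -> U K'.
Definition hborel : set (set (set V)) := <<s Kc, hopen >>.

End FuzzyDefs.

Section ProbDefs.
Context {dT : measure_display} {T : measurableType dT} {R : realType}.
Variable P : probability T R.

Definition normal_rv (X : T -> R) : Prop :=
  measurable_fun setT X /\
  exists m s : R, 0 <= s /\ forall A : set R, measurable A ->
    P (X @^-1` A) = (if s == 0 then \d_m A else normal_prob m s A).

(** independent increments, tested on the sigma-algebras generated by a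
    family Phi of real functionals: for 0 <= t_0 < t_1 < ... < t_n, the events
    {Phi_{k,i}(Y_{t_{k+1}} - Y_{t_k}) in A_{k,i} for all i}, k < n, are
    mutually independent (finite intersections of such sets form a pi-system
    generating sigma(phi(Y_{t_{k+1}} - Y_{t_k}) : phi in Phi)). *)
Definition indep_increments {Vt : Type} (sub : Vt -> Vt -> Vt)
    (Phi : set (Vt -> R)) (Y : R -> T -> Vt) : Prop :=
  forall (n : nat) (t : nat -> R) (m : nat)
      (f : 'I_n -> 'I_m -> Vt -> R) (A : 'I_n -> 'I_m -> set R),
    0 <= t 0%N -> (forall k, (k < n)%N -> t k < t k.+1) ->
    (forall k i, Phi (f k i)) -> (forall k i, measurable (A k i)) ->
    let E := fun k : 'I_n => [set w | forall i : 'I_m,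
               A k i (f k i (sub (Y (t k.+1) w) (Y (t k) w)))] in
    fine (P [set w | forall k : 'I_n, E k w]) = \prod_(k < n) fine (P (E k)).

Definition complete_prob : Prop :=
  forall N : set T, P.-negligible N -> measurable N.

Definition usual_filtration (F : R -> set (set T)) : Prop :=
  [/\ (forall t, 0 <= t -> sigma_algebra setT (F t) /\ F t `<=` measurable),
      (forall s t, 0 <= s <= t -> F s `<=` F t),
      (forall t, 0 <= t -> forall A, F t A <-> (forall s, t < s -> F s A)) &
      (forall N, measurable N -> P N = 0%E -> F 0 N)].

Definition adapted_fuzzy {d : nat} (F : R -> set (set T))
    (B : R -> T -> 'rV[R]_d -> R) : Prop :=
  forall t, 0 <= t -> forall al, 0 < al <= 1 ->
    forall U, hborel U -> F t [set w | U (level (B t w) al)].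

Definition fuzzy_BM {d : nat} (B : R -> T -> 'rV[R]_d -> R) : Prop :=
  let s := fun t w => sfun (B t w) in
  [/\
      {ae P, forall w, B 0 w = ind1 0},
      (forall (n m : nat) (L : 'I_n -> (R -> 'rV[R]_d -> R) -> R)
              (t : 'I_m -> R) (c : 'I_n -> 'I_m -> R),
         (forall i, Cbar_dual (L i)) -> (forall j, 0 <= t j) ->
         normal_rv (fun w => \sum_(i < n) \sum_(j < m) c i j * L i (s (t j) w))),
      (forall t L, 0 <= t -> Cbar_dual L ->
         (\int[P]_w (L (s t w))%:E = 0)%E),
      indep_increments (fun f g : R -> 'rV[R]_d -> R => fun al x => f al x - g al x)
        (@Cbar_dual R d) s &
      (exists Q : ((R -> 'rV[R]_d -> R) -> R) -> ((R -> 'rV[R]_d -> R) -> R) -> R,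
         forall L1 L2 t1 t2, Cbar_dual L1 -> Cbar_dual L2 -> 0 <= t1 -> 0 <= t2 ->
           (\int[P]_w (L1 (s t1 w) * L2 (s t2 w))%:E
              = (Order.min t1 t2 * Q L1 L2)%:E)%E)].

Definition wiener {d : nat} (b : R -> T -> 'rV[R]_d) : Prop :=
  [/\ {ae P, forall w, b 0 w = 0},
      (forall (m : nat) (t : 'I_m -> R) (c : 'I_m -> 'I_d -> R),
         (forall j, 0 <= t j) ->
         normal_rv (fun w => \sum_(j < m) \sum_(i < d) c j i * b (t j) w ord0 i)),
      (forall t i, 0 <= t -> (\int[P]_w (b t w ord0 i)%:E = 0)%E),
      indep_increments (fun x y => x - y) [set (fun x => x ord0 i) | i in setT] b &
      (exists Sig : 'M[R]_d, forall s t i j, 0 <= s <= t ->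
         normal_rv (fun w => b t w ord0 i - b s w ord0 i) /\
         (\int[P]_w ((b t w ord0 i - b s w ord0 i) * (b t w ord0 j - b s w ord0 j))%:E
            = ((t - s) * Sig i j)%:E)%E)].

End ProbDefs.

(* Main.v *)
Require Import Defs.
From HB Require Import structures.
From mathcomp Require Import all_boot all_order all_algebra.
From mathcomp Require Import all_classical all_reals all_analysis.
From mathcomp Require Import measurable_realfun.
From mathcomp Require Import ring lra.
(* [Defs] is imported again because all_analysis has its own [sfun]. *)
Import Order.TTheory GRing.Theory Num.Theory numFieldNormedType.Exports Defs.
Local Open Scope classical_set_scope.
Local Open Scope ring_scope.
Set Implicit Arguments. Unset Strict Implicit. Unset Printing Implicit Defensive.

(* The width s(0,e) + s(0,-e) of the support of B_t in the direction e is
   nonnegative, and for a fuzzy Brownian motion it has expectation zero, so it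
   vanishes almost surely. Applied to the d coordinate axes this forces the
   support to be a single point b_t, whose coordinates are evaluations of the
   support function, hence inherit the Brownian properties.
   Conversely, for B_t = 1_{b_t} every functional of s(B_t) is almost surely a
   fixed linear combination of the coordinates of b_t. Independence of the
   increments passes from coordinates to linear combinations by the pi-lambda
   theorem, and independence of b_s and b_t - b_s turns the covariance of the
   increments into the (s /\ t) form. *)

(** * Support functions and the dual of Cbar *)

Section SupportFunctions.
Context {R : realType} {d : nat}.
Implicit Types (a b x : 'rV[R]_d) (al : R) (f g : R -> 'rV[R]_d -> R)
  (nu : 'rV[R]_d -> R).

Definition axis (i : 'I_d) : 'rV[R]_d := delta_mx ord0 i.

Lemma dotv_axis i a : dotv (axis i) a = a ord0 i.
Proof.
rewrite /dotv (bigD1 i)//= big1 ?addr0; first by rewrite mxE !eqxx mul1r.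
by move=> j ji; rewrite mxE (negbTE ji) mul0r.
Qed.

Lemma dotvC x a : dotv x a = dotv a x.
Proof. by apply: eq_bigr => i _; rewrite mulrC. Qed.

Lemma dotvDr x a b : dotv x (a + b) = dotv x a + dotv x b.
Proof. by rewrite -big_split; apply: eq_bigr => i _; rewrite mxE mulrDr. Qed.

Lemma dotvZr x (c : R) a : dotv x (c *: a) = c * dotv x a.
Proof. by rewrite mulr_sumr; apply: eq_bigr => i _; rewrite mxE mulrCA. Qed.

Lemma dotvBr x a b : dotv x (a - b) = dotv x a - dotv x b.
Proof. by rewrite -scaleN1r dotvDr dotvZr mulN1r. Qed.

Lemma dotvNl x a : dotv (- x) a = - dotv x a.
Proof. by rewrite dotvC -scaleN1r dotvZr mulN1r dotvC. Qed.

Lemma sphere_axis i : sphere (axis i).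
Proof. by rewrite /sphere /= /enorm dotv_axis mxE !eqxx sqrtr1. Qed.

Lemma sphereN x : sphere x -> sphere (- x).
Proof. by rewrite /sphere /= /enorm dotvNl dotvC dotvNl opprK. Qed.

Lemma sphere_coord x i : sphere x -> `|x ord0 i| <= 1.
Proof.
rewrite /sphere /= /enorm => x1.
rewrite -(@ler_pXn2r _ 2)// ?nnegrE// expr1n real_normK ?num_real// expr2.
have -> : 1 = dotv x x.
  rewrite -[LHS](expr1n _ 2) -x1 sqr_sqrtr//.
  by apply: sumr_ge0 => j _; rewrite -expr2 sqr_ge0.
rewrite /dotv (bigD1 i)//= lerDl.
by apply: sumr_ge0 => j _; rewrite -expr2 sqr_ge0.
Qed.

Lemma sphere_dotv_le x a : sphere x -> `|dotv x a| <= \sum_(i < d) `|a ord0 i|.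
Proof.
move=> x1; apply: le_trans (ler_norm_sum _ _ _) _.
apply: ler_sum => i _; rewrite normrM ler_piMl//; exact: sphere_coord.
Qed.

(* Stated over an arbitrary topological domain: on ['rV_d] itself the inference
   of the neighborhood filter unfolds too far for the [cvg] lemmas to apply. *)
Lemma continuous_dotv (U : topologicalType) (h : U -> 'rV[R]_d) a :
  (forall i, continuous (fun t => h t ord0 i)) ->
  continuous (fun t => dotv (h t) a).
Proof.
move=> hc; rewrite /dotv; elim: (index_enum _) => [|i s IHs] x.
  under eq_fun do rewrite big_nil; exact: cvg_cst.
under eq_fun do rewrite big_cons; apply: cvgD; last exact: IHs.
by apply: cvgM; [exact: hc|exact: cvg_cst].
Qed.

Lemma dotv_continuous a : continuous (fun x => dotv x a).
Proof.
by apply: (@continuous_dotv 'rV[R]_d id) => i; exact: coord_continuous.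
Qed.

(** This is the support function of the singleton of [a]. It is constant in the level, so every
    one-sided limit condition holds with an arbitrary radius. *)
Lemma in_Cbar_dotv a : in_Cbar (fun _ x => dotv x a).
Proof.
have within_dotv : {within @sphere R d, continuous (fun x => dotv x a)}.
  by apply: continuous_subspaceT => x; exact: dotv_continuous.
split => //.
- by exists (\sum_(i < d) `|a ord0 i|) => al x _; exact: sphere_dotv_le.
- by move=> al _ e e0; exists 1 => // *; rewrite subrr normr0 ltW.
- by move=> e e0; exists 1 => // *; rewrite subrr normr0 ltW.
- move=> al _; exists (fun x => dotv x a); split => // e e0.
  by exists 1 => // *; rewrite subrr normr0 ltW.
Qed.

Lemma eq_in_Cbar f g : (forall al x, 0 <= al <= 1 -> f al x = g al x) ->
  in_Cbar f -> in_Cbar g.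
Proof.
move=> fg [cf [M fM] lf rf hf]; split.
- by move=> al al01; rewrite -(funext (fun x => fg al x al01)); exact: cf.
- by exists M => al x al01 x1; rewrite -fg//; exact: fM.
- move=> al /andP[al0 al1] e e0; have [|r r0 fr] := lf al _ e e0.
    by rewrite al0.
  exists r => // be x /andP[be0 beal] albe x1.
  rewrite -!fg ?be0 ?(ltW al0)//= ?(le_trans beal)//.
  by apply: fr; rewrite ?be0.
- move=> e e0; have [r r0 fr] := rf e e0; exists r => // be x be01 ber x1.
  by rewrite -!fg ?lexx ?ler01//; exact: fr.
- move=> al al01; have [h [ch fh]] := hf al al01; exists h; split=> // e e0.
  have [r r0 fr] := fh e e0; exists r => // be x /andP[albe be1] ber x1.
  rewrite -fg; first by apply: fr; rewrite ?albe.
  by case/andP: al01 => al0 _; rewrite be1 (ltW (lt_trans al0 albe)).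
Qed.

Lemma Cbar_norm_ge f al x : in_Cbar f -> 0 <= al <= 1 -> sphere x ->
  `|f al x| <= Cbar_norm f.
Proof.
move=> [_ [M fM] _ _ _] al01 x1; apply: ub_le_sup; last by exists (al, x).
by exists M => _ [[be y] [/= be01 y1] <-]; exact: fM.
Qed.

(** Passing from a fuzzy Brownian motion to a Wiener process tests only these functionals, at level
    0 and in the directions of plus or minus an axis. *)
Lemma Cbar_dual_eval al x : 0 <= al <= 1 -> sphere x ->
  Cbar_dual (fun f => f al x).
Proof.
move=> al01 x1; split => //; exists 1 => f fC.
by rewrite mul1r; exact: Cbar_norm_ge.
Qed.

Lemma Cbar_norm0 f : (forall al x, 0 <= al <= 1 -> f al x = 0) ->
  Cbar_norm f = 0.
Proof.
move=> f0; rewrite /Cbar_norm; set S := (X in sup X).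
(* For [d = 0] the sphere is empty and so is [S]; then the value 0 is the default of [sup] on the
   empty set. *)
have S0 : S `<=` [set 0].
  by move=> _ [[al x] [/= al01 x1] <-] /=; rewrite f0// normr0.
by have [->|->] := subset_set1 S0; rewrite ?sup0 ?sup1.
Qed.

(** [L] acts on representatives defined for all real levels. Two representatives of the same element
    differ by a function of norm zero, which boundedness forces [L] to kill. *)
Lemma eq_Cbar_dual L f g : Cbar_dual L -> in_Cbar g ->
  (forall al x, 0 <= al <= 1 -> f al x = g al x) -> L f = L g.
Proof.
move=> [LD LZ [M LM]] gC fg; pose h al x := f al x - g al x.
have h0 al x : 0 <= al <= 1 -> h al x = 0 by move=> al01; rewrite /h fg// subrr.
have hC : in_Cbar h.
  apply: (@eq_in_Cbar (fun _ x => dotv x 0)); last exact: in_Cbar_dotv.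
  by move=> al x al01; rewrite h0// -(scale0r 0) dotvZr mul0r.
have Lh0 : L h = 0.
  apply/eqP; rewrite -normr_le0; apply: le_trans (LM _ hC) _.
  by rewrite (Cbar_norm0 h0) mulr0.
have -> : f = fun al x => g al x + h al x.
  by apply/funext => al; apply/funext => x; rewrite addrC subrK.
by rewrite LD// Lh0 addr0.
Qed.

(** The map sending [a] to [L (fun _ x => dotv x a)] is a linear form on a finite-dimensional space,
    so its values on the axes determine it. *)
Lemma Cbar_dual_dotv L a : Cbar_dual L ->
  L (fun _ x => dotv x a) = \sum_(i < d) L (fun _ x => dotv x (axis i)) * a ord0 i.
Proof.
move=> [LD LZ _]; rewrite [in LHS](row_sum_delta a).
pose l v := L (fun _ x => dotv x v).
have lD u v : l (u + v) = l u + l v.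
  rewrite /l -LD; [|exact: in_Cbar_dotv|exact: in_Cbar_dotv].
  by congr L; apply/funext => al; apply/funext => x; rewrite dotvDr.
have lZ c u : l (c *: u) = c * l u.
  rewrite /l -LZ; last exact: in_Cbar_dotv.
  by congr L; apply/funext => al; apply/funext => x; rewrite dotvZr.
have l0 : l 0 = 0 by rewrite -(scale0r 0) lZ mul0r.
rewrite -/(l _) (big_morph l lD l0).
by apply: eq_bigr => i _; rewrite lZ mulrC.
Qed.

Lemma level_ind1 a al : 0 < al <= 1 -> level (ind1 a) al = [set a].
Proof.
move=> /andP[al0 al1]; apply/seteqP; split=> x; rewrite /level /ind1 /=.
  by case: eqP => // _; rewrite leNgt al0.
by move=> ->; rewrite eqxx.
Qed.

Lemma fsupport_ind1 a : fsupport (ind1 a) = [set a].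
Proof.
rewrite /fsupport (_ : [set x | _] = [set a]).
  apply/esym/closure_id/accessible_closed_set1.
  exact/hausdorff_accessible/norm_hausdorff.
apply/seteqP; split=> x; rewrite /ind1 /=; first by case: eqP; rewrite // ltxx.
by move=> ->; rewrite eqxx ltr01.
Qed.

Lemma sfun_ind1 a al x : 0 <= al <= 1 -> sfun (ind1 a) al x = dotv x a.
Proof.
move=> /andP[al0 al1]; rewrite /sfun; case: eqP => [_|/eqP al_neq0].
  by rewrite fsupport_ind1 image_set1 sup1.
by rewrite level_ind1 ?lt0r ?al_neq0 ?al0// image_set1 sup1.
Qed.

(** * Fuzzy sets of zero width *)

Section Singleton.
Variable nu : 'rV[R]_d -> R.
Hypothesis nuF : fuzzy_kc nu.

Lemma fsupport_level1 a : level nu 1 a -> fsupport nu a.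
Proof.
by move=> a1; apply: subset_closure; exact: lt_le_trans ltr01 a1.
Qed.

Lemma dotv_le_sfun0 a x : fsupport nu a -> dotv x a <= sfun nu 0 x.
Proof.
case: nuF => _ _ _ nuK _ nua; rewrite /sfun eqxx.
apply: ub_le_sup; last by exists a.
(* The supremum is an upper bound only of a set bounded above; compactness of the support provides
   this. The bound holds for every real strictly above [M], hence [M + 1]. *)
have /compact_bounded [M [Mr /(_ (M + 1))]] : compact (dotv x @` fsupport nu).
  apply: continuous_compact => //; apply: continuous_subspaceT => y.
  by rewrite (_ : dotv x = fun z => dotv z x)
             ?(funext (fun z => dotvC x z))//; exact: dotv_continuous.
rewrite ltrDl ltr01 => /(_ isT) xM; exists (M + 1) => _ [y nuy <-].
by apply: le_trans (ler_norm _) _; apply: xM; exists y.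
Qed.

Lemma sfun0_width_ge0 x : 0 <= sfun nu 0 x + sfun nu 0 (- x).
Proof.
case: (nuF) => _ _ [a /fsupport_level1 nua] _ _.
have := dotv_le_sfun0 x nua; have := dotv_le_sfun0 (- x) nua.
rewrite dotvNl; lra.
Qed.

(** In each axis direction the support lies between two hyperplanes, and zero width makes them
    coincide. Hence the support is at most one point, and a point of level 1, which exists by
    [fuzzy_kc], must be that point. *)
Lemma fuzzy_zero_width :
  (forall i, sfun nu 0 (axis i) + sfun nu 0 (- axis i) = 0) ->
  nu = ind1 (\row_i sfun nu 0 (axis i)).
Proof.
move=> width0; set b := \row_i _.
have nub x : fsupport nu x -> x = b.
  move=> nux; apply/rowP => i; rewrite mxE; apply/eqP.
  have := dotv_le_sfun0 (axis i) nux; have := dotv_le_sfun0 (- axis i) nux.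
  rewrite eq_le dotvNl dotv_axis => lex ->; have := width0 i; move: lex; lra.
case: (nuF) => nu01 _ [a a1] _ _.
have ab := nub _ (fsupport_level1 a1).
apply/funext => x; rewrite /ind1; case: eqP => [->|xb].
  by apply/le_anti; rewrite -ab a1 andbT; case/andP: (nu01 a).
apply/le_anti; case/andP: (nu01 x) => -> _; rewrite andbT leNgt.
by apply/negP => nux; apply: xb; apply: nub; exact: subset_closure.
Qed.

End Singleton.

Lemma Cbar_dual_sfun_ind1 L a : Cbar_dual L ->
  L (sfun (ind1 a)) = \sum_(i < d) L (fun _ x => dotv x (axis i)) * a ord0 i.
Proof.
move=> LC; rewrite -Cbar_dual_dotv//; apply: eq_Cbar_dual => //.
  exact: in_Cbar_dotv.
by move=> al x al01; exact: sfun_ind1.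
Qed.

Lemma Cbar_dual_sfun_ind1B L a b : Cbar_dual L ->
  L (fun al x => sfun (ind1 a) al x - sfun (ind1 b) al x) =
  \sum_(i < d) L (fun _ x => dotv x (axis i)) * (a - b) ord0 i.
Proof.
move=> LC; rewrite -Cbar_dual_dotv//; apply: eq_Cbar_dual => //.
  exact: in_Cbar_dotv.
by move=> al x al01; rewrite !sfun_ind1// dotvBr.
Qed.

End SupportFunctions.

(** * Expectation and independence *)

Section Probability.
Context {dT : measure_display} {T : measurableType dT} {R : realType}.
Variable P : probability T R.
Implicit Types (A B C N : set T) (X Y : T -> R) (r s : R).

(** The set where [A] and [B] differ is negligible, and completeness makes each of its subsets
    measurable. *)
Lemma ae_set_measurable A B : complete_prob P -> measurable A ->
  {ae P, forall w, A w <-> B w} -> measurable B /\ P B = P A.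
Proof.
move=> Pc mA AB.
pose N := ~` [set w | A w <-> B w].
have NP : P.-negligible N by [].
have mN := Pc _ NP.
have mNB C : measurable (N `\` C).
  by apply: Pc; apply: negligibleS NP => w [].
(* Adding [N] to [A] and then removing the part of [N] outside [B] changes [A] only by measurable
   null sets. *)
have -> : B = (A `|` N) `\` (N `\` B).
  apply/seteqP; split=> w /=.
    move=> Bw; split; last by case.
    by have [Aw|nAw] := pselect (A w); [left|right=> /= -[_ /(_ Bw)]].
  move=> [AN nNB]; apply: contrapT => nBw; case: AN => [Aw|Nw]; apply: nNB.
    by split=> // -[/(_ Aw)].
  by split.
have mAN : measurable (A `|` N) by exact: measurableU.
split; first exact: measurableD.
rewrite measureD//; last by rewrite (le_lt_trans (probability_le1 _ _)) ?ltry.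
rewrite [X in (_ - X)%E](_ : _ = 0%E) ?sube0; last first.
  apply: measure_negligible; first exact: measurableI.
  by apply: negligibleS NP => w [_ []].
apply: measureU0 => //. exact: measure_negligible.
Qed.

Lemma ae_measurable_fun X Y : complete_prob P -> {ae P, forall w, X w = Y w} ->
  measurable_fun setT X -> measurable_fun setT Y.
Proof.
move=> Pc XY mX _ A mA; rewrite setTI.
have mXA : measurable (X @^-1` A) by rewrite -[X @^-1` _]setTI; exact: mX.
apply: (@ae_set_measurable _ _ Pc mXA _).1.
by apply: filterS XY => w; rewrite /preimage /= => ->.
Qed.

Lemma normal_rv_ae X Y : complete_prob P -> {ae P, forall w, X w = Y w} ->
  normal_rv P X -> normal_rv P Y.
Proof.
move=> Pc XY [mX [m [s [s0 XA]]]]; split; first exact: ae_measurable_fun XY mX.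
exists m, s; split => // A mA; rewrite -XA//.
apply: (@ae_set_measurable _ _ Pc _ _).2.
  by rewrite -[X @^-1` _]setTI; exact: mX.
by apply: filterS XY => w; rewrite /preimage /= => ->.
Qed.

(** Integrability is bundled with the value, because linearity of the integral requires it. *)
Definition has_exp X r := P.-integrable setT (EFin \o X) /\
  (\int[P]_w (X w)%:E = r%:E)%E.

(** The integral is the difference of those of the positive and negative parts. If either were
    infinite, the difference would be too, the convention for oo - oo included; so a finite value
    gives integrability. *)
Lemma has_exp_integral X r : measurable_fun setT X ->
  (\int[P]_w (X w)%:E = r%:E)%E -> has_exp X r.
Proof.
move=> mX EX; split => //; apply/integrableP.
have mEX : measurable_fun setT (EFin \o X) by exact/measurable_EFinP.
split => //; rewrite (_ : (fun w => _) = abse \o (EFin \o X))//.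
rewrite fune_abse ge0_integralD//=; last 2 first.
- exact: measurable_funepos.
- exact: measurable_funeneg.
have : (\int[P]_w (EFin \o X) w \is a fin_num)%E by rewrite EX.
rewrite integralE.
have : (0 <= \int[P]_w ((EFin \o X)^\+ w))%E by exact: integral_ge0.
have : (0 <= \int[P]_w ((EFin \o X)^\- w))%E by exact: integral_ge0.
case: (\int[P]_w ((EFin \o X)^\+ w))%E => [p| |];
  by case: (\int[P]_w ((EFin \o X)^\- w))%E => [q| |] // *; rewrite ltry.
Qed.

Lemma has_exp_measurable X r : has_exp X r -> measurable_fun setT X.
Proof. by move=> [/measurable_int/measurable_EFinP]. Qed.

Lemma has_expD X Y r s : has_exp X r -> has_exp Y s ->
  has_exp (fun w => X w + Y w) (r + s).
Proof.
move=> [iX EX] [iY EY]; split; last first.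
  by under eq_integral do rewrite EFinD; rewrite integralD// EX EY.
by apply: eq_integrable (integrableD _ iX iY).
Qed.

Lemma has_expZ (c : R) X r : has_exp X r -> has_exp (fun w => c * X w) (c * r).
Proof.
move=> [iX EX]; split; last first.
  by under eq_integral do rewrite EFinM; rewrite integralZl// EX.
by apply: eq_integrable (integrableZl _ c iX).
Qed.

Lemma has_exp0 : has_exp (fun _ => 0) 0.
Proof. by apply: has_exp_integral; [exact: measurable_cst|rewrite integral0]. Qed.

Lemma has_exp_sum (I : Type) (s : seq I) (X : I -> T -> R) (r : I -> R) :
  (forall i, has_exp (X i) (r i)) ->
  has_exp (fun w => \sum_(i <- s) X i w) (\sum_(i <- s) r i).
Proof.
move=> Xr; elim: s => [|i s IHs].
  by under eq_fun do rewrite big_nil; rewrite big_nil; exact: has_exp0.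
by under eq_fun do rewrite big_cons; rewrite big_cons; exact: has_expD.
Qed.

Lemma has_exp_ae X Y r : complete_prob P -> {ae P, forall w, X w = Y w} ->
  has_exp X r -> has_exp Y r.
Proof.
move=> Pc XY Xr; have mX := has_exp_measurable Xr.
have mY := ae_measurable_fun Pc XY mX.
apply: has_exp_integral => //; rewrite -(proj2 Xr).
apply: ae_eq_integral => //; [exact/measurable_EFinP|exact/measurable_EFinP|].
by apply: filterS XY => w -> _.
Qed.

Lemma has_exp_eq X r s : has_exp X r -> has_exp X s -> r = s.
Proof. by move=> [_ Er] [_]; rewrite Er => -[]. Qed.

Lemma has_exp_ge0_eq0 X : (forall w, 0 <= X w) -> has_exp X 0 ->
  {ae P, forall w, X w = 0}.
Proof.
move=> X0 EX; have mX := has_exp_measurable EX.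
have /ae_eq_integral_abs : measurable_fun setT (EFin \o X).
  exact/measurable_EFinP.
move=> /(_ P measurableT) [+ _]; rewrite (_ : (\int[P]_x _)%E = 0%E); last first.
  by rewrite -[RHS](proj2 EX); apply: eq_integral => w _ /=; rewrite ger0_norm.
by move=> /(_ erefl); apply: filterS => w /(_ I)[].
Qed.

(** The product is dominated by [X ^ 2 + Y ^ 2], since both [(X + Y) ^ 2] and [(X - Y) ^ 2] are
    nonnegative. *)
Lemma has_expM_square X Y r s : measurable_fun setT X -> measurable_fun setT Y ->
  has_exp (fun w => X w * X w) r -> has_exp (fun w => Y w * Y w) s ->
  exists q, has_exp (fun w => X w * Y w) q.
Proof.
move=> mX mY XX YY; have [iXY _] := has_expD XX YY.
have iM : P.-integrable setT (EFin \o (fun w => X w * Y w)).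
  apply: le_integrable iXY => //.
    by apply/measurable_EFinP; exact: measurable_funM.
  move=> w _; rewrite /= lee_fin ler_norml [`|_ + _|]ger0_norm; last first.
    by rewrite addr_ge0// -expr2 sqr_ge0.
  have := sqr_ge0 (X w + Y w); have := sqr_ge0 (X w - Y w).
  have := sqr_ge0 (X w); have := sqr_ge0 (Y w).
  by move=> *; apply/andP; split; lra.
exists (fine (\int[P]_w (X w * Y w)%:E)%E); split => //.
by rewrite fineK//; exact: integrable_fin_num.
Qed.

(** Under independence the joint law is the product of the marginal laws. By Fubini the inner
    integral at [x] is [x] times the expectation of [Y], which is zero. *)
Lemma indep_has_expM X Y q : measurable_fun setT X -> has_exp Y 0 ->
  has_exp (fun w => X w * Y w) q ->
  (forall A B : set R, measurable A -> measurable B ->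
    P (X @^-1` A `&` Y @^-1` B) = (P (X @^-1` A) * P (Y @^-1` B))%E) ->
  q = 0.
Proof.
move=> mX EY EXY indep; have mY := has_exp_measurable EY.
pose X' : {mfun T >-> R} := mfun_Sub (mem_set mX).
pose Y' : {mfun T >-> R} := mfun_Sub (mem_set mY).
have mXY : measurable_fun setT (fun w => (X w, Y w)).
  exact/measurable_fun_pairP.
pose XY' : {mfun T >-> (R * R)%type} := mfun_Sub (mem_set mXY).
pose f (z : R * R) := (z.1 * z.2)%:E.
have mf : measurable_fun setT f.
  by apply/measurable_EFinP; exact: measurable_funM.
have prodE (S : set (R * R)) : measurable S ->
    (distribution P X' \x distribution P Y')%E S = distribution P XY' S.
  by apply: product_measure_unique => A B mA mB; exact: indep.
have EXY' : (\int[distribution P XY']_z f z = q%:E)%E.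
  by rewrite integral_distribution//; case: EXY.
(* Fubini needs integrability under the product law; it is carried over from the joint law, which is
   the same measure. *)
have if_ : (distribution P X' \x distribution P Y')%E.-integrable setT f.
  have : (distribution P XY').-integrable setT f.
    by apply: integrable_pushforward => //; case: EXY.
  move=> /integrableP[_ ioo]; apply/integrableP; split => //.
  by rewrite (eq_measure_integral (distribution P XY'))// => S mS _; exact: prodE.
have EXYprod : (\int[distribution P X' \x distribution P Y']_z f z = q%:E)%E.
  by rewrite -EXY'; apply: eq_measure_integral => S mS _; exact: prodE.
have : (q%:E = 0%:E)%E; last by case.
rewrite -EXYprod -integral12_prod_meas1// integral0_eq// => x _.
rewrite /fubini_F /f /=; under eq_integral do rewrite EFinM.
have iY : (distribution P Y').-integrable setT EFin.
  by apply: integrable_pushforward => //; case: EY.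
rewrite integralZl// integral_distribution//; last by case: EY.
by rewrite (proj2 EY) mule0.
Qed.

Lemma indep_sigma_cond (G : set (set T)) C : measurable C ->
  G setT -> setI_closed G -> G `<=` measurable ->
  (forall A, G A -> P (A `&` C) = (P A * P C)%E) ->
  forall A, <<s G >> A -> P (A `&` C) = (P A * P C)%E.
Proof.
move=> mC GT GI Gm GC A GA.
have Pc0 : 0 <= fine (P C) by exact: fine_ge0.
(* Both sides of the product formula are finite measures in [A]: [m1] the left one, [m2] the right
   one. They agree on the pi-system [G], hence on the sigma-algebra it generates. *)
pose m1 : {measure set T -> \bar R} := mrestr P mC.
pose m2 : {measure set T -> \bar R} := mscale (NngNum Pc0) P.
have m2E B : m2 B = (P B * P C)%E.
  by rewrite /m2/= /mscale/= fineK ?fin_num_measure// muleC.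
rewrite -m2E; apply: (g_sigma_algebra_measure_unique G Gm (fun=> setT) _ _ m1 m2) => //.
- by rewrite bigcup_const.
- by move=> B /GC; rewrite -m2E.
- by move=> _; rewrite /m1/= /mrestr (le_lt_trans (probability_le1 _ _)) ?ltry//;
    exact: measurableI.
Qed.

Lemma indep_sigma n (G : 'I_n -> set (set T)) :
  (forall k, G k setT) -> (forall k, setI_closed (G k)) ->
  (forall k, G k `<=` measurable) ->
  (forall E, (forall k, G k (E k)) ->
    fine (P [set w | forall k, E k w]) = \prod_(k < n) fine (P (E k))) ->
  forall E, (forall k, <<s G k >> (E k)) ->
    fine (P [set w | forall k, E k w]) = \prod_(k < n) fine (P (E k)).
Proof.
move=> GT GI Gm indepG.
have sGm k A : <<s G k >> A -> measurable A.
  exact: (smallest_sub (@sigma_algebra_measurable _ T) (Gm k)).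
have mE (E : 'I_n -> set T) : (forall k, measurable (E k)) ->
    measurable [set w | forall k, E k w].
  move=> mE; rewrite (_ : [set w | _] = \bigcap_(k in setT) E k).
    by apply: fin_bigcap_measurable => // *; exact: mE.
  by apply/seteqP; split=> w /= h k //; exact: h.
(* The pi-systems are replaced one index at a time: the event of index k lies
   in <<s G k>> for k < j, in G k for k >= j. *)
suff indepj j : (j <= n)%N -> forall E : 'I_n -> set T,
    (forall k : 'I_n, if (k < j)%N then <<s G k >> (E k) else G k (E k)) ->
    fine (P [set w | forall k, E k w]) = \prod_(k < n) fine (P (E k)).
  move=> E sE; apply: (indepj n (leqnn n)) => k; by rewrite ltn_ord.
elim: j => [_ E GE|j IHj jn E GE]; first by apply: indepG => k; exact: GE.
pose j' := Ordinal jn.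
(* [up A] puts [A] in place of the event of index [j'], and [C] is the intersection of all the other
   events. *)
pose up A : 'I_n -> set T := fun k => if k == j' then A else E k.
pose C := [set w | forall k, up setT k w].
have Em k : measurable (E k).
  by have := GE k; case: ifP => _; [exact: sGm|exact: Gm].
have mup A k : measurable A -> measurable (up A k).
  by move=> mA; rewrite /up; case: ifP.
have mC : measurable C by apply: mE => k; exact: mup.
have upE A : [set w | forall k, up A k w] = A `&` C.
  apply/seteqP; split=> w /=.
    move=> h; split; first by have := h j'; rewrite /up eqxx.
    by move=> k; have := h k; rewrite /up; case: ifP.
  by move=> [Aw Cw] k; have := Cw k; rewrite /up; case: ifP.
(* For [A] in [G j'] the family [up A] falls under the induction hypothesis at [j]. So [C] is
   independent of the pi-system [G j'], and [indep_sigma_cond] extends this to [<<s G j' >>]. *)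
have upG A : G j' A -> fine (P (A `&` C)) =
    fine (P A) * \prod_(k < n | k != j') fine (P (E k)).
  move=> GA; rewrite -upE IHj ?(ltnW jn)//; last first.
    move=> k; rewrite /up; case: eqP => [->|/eqP kj] /=; first by rewrite ltnn.
    have := GE k; rewrite ltnS leq_eqVlt; case: eqP => //= kj'.
    by case/eqP: kj; apply: val_inj.
  rewrite (bigD1 j')//= /up eqxx; congr (_ * _).
  by apply: eq_bigr => k /negbTE ->.
(* The case [A = setT] computes the probability of [C] itself. *)
have PC : fine (P C) = \prod_(k < n | k != j') fine (P (E k)).
  by have := upG _ (GT j'); rewrite setTI probability_setT mul1r.
have finP A : measurable A -> P A \is a fin_num by exact: fin_num_measure.
have -> : [set w | forall k, E k w] = E j' `&` C.
  rewrite -upE; congr [set w | _]; apply/funext => w.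
  by apply/propext; split=> h k; have := h k; rewrite /up; case: eqP => // ->.
rewrite (@indep_sigma_cond (G j') C)//.
- by rewrite fineM ?finP// PC [RHS](bigD1 j').
- move=> A GA; have mA := Gm _ _ GA.
  apply/eqP; rewrite -[P (_ `&` _)]fineK ?finP//; last exact: measurableI.
  by rewrite upG// -PC EFinM !fineK ?finP.
- by have := GE j'; rewrite ltnSn.
Qed.

End Probability.

(** * Wiener processes *)

Section Wiener.
Context {dT : measure_display} {T : measurableType dT} {R : realType} {d : nat}.
Variables (P : probability T R) (b : R -> T -> 'rV[R]_d).
Hypotheses (Pc : complete_prob P) (bW : wiener P b).

Lemma wiener_measurable t i : 0 <= t ->
  measurable_fun setT (fun w => b t w ord0 i).
Proof.
case: bW => _ bN _ _ _ t0.
have [+ _] := bN 1%N (fun=> t) (fun _ k => (k == i)%:R) (fun=> t0).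
apply: eq_measurable_fun => w _; rewrite big_ord1 (bigD1 i)//= big1.
  by rewrite eqxx mul1r addr0.
by move=> k /negbTE ->; rewrite mul0r.
Qed.

Lemma wiener_exp t i : 0 <= t -> has_exp P (fun w => b t w ord0 i) 0.
Proof.
case: (bW) => _ _ bE _ _ t0.
by apply: has_exp_integral; [exact: wiener_measurable|rewrite bE].
Qed.

Lemma wiener_exp_incr s t i : 0 <= s -> 0 <= t ->
  has_exp P (fun w => b t w ord0 i - b s w ord0 i) 0.
Proof.
move=> s0 t0; have := has_expD (wiener_exp i t0) (has_expZ (-1) (wiener_exp i s0)).
rewrite mulr0 addr0; congr has_exp.
by apply/funext => w; rewrite mulN1r.
Qed.

Lemma wiener_measurable_incr s t i : 0 <= s -> 0 <= t ->
  measurable_fun setT (fun w => b t w ord0 i - b s w ord0 i).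
Proof.
by move=> s0 t0; exact: has_exp_measurable (wiener_exp_incr i s0 t0).
Qed.

(** The pair is [b s - b 0] and [b t - b s] because [wiener] gives independence of increments along
    strictly increasing times, here 0, [s], [t]; [b 0] vanishes only almost surely. *)
Lemma wiener_independent_incr (s t : R) i j (A A' : set R) : 0 < s -> s < t ->
  measurable A -> measurable A' ->
  let X w := b s w ord0 i - b 0 w ord0 i in
  let Y w := b t w ord0 j - b s w ord0 j in
  P (X @^-1` A `&` Y @^-1` A') = (P (X @^-1` A) * P (Y @^-1` A'))%E.
Proof.
move=> s0 st mA mA' X Y; case: (bW) => _ _ _ bI _.
have ms : measurable (X @^-1` A).
  rewrite -[X in measurable X]setTI.
  by apply: wiener_measurable_incr => //; exact: ltW.
have mt : measurable (Y @^-1` A').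
  rewrite -[X in measurable X]setTI.
  by apply: wiener_measurable_incr => //; rewrite ltW// (lt_trans s0).
(* In [wiener] the coordinate functionals elaborate to functionals of
   ['I_1 -> 'I_d -> R], not of ['rV_d]. *)
pose f (k : 'I_2) (_ : 'I_1) : ('I_1 -> 'I_d -> R) -> R :=
  if k == ord0 then fun x => x ord0 i else fun x => x ord0 j.
pose D (k : 'I_2) (_ : 'I_1) := if k == ord0 then A else A'.
have := bI 2%N (nth 0 [:: 0; s; t]) 1%N f D (lexx _).
have incr k : (k < 2)%N -> nth 0 [:: 0; s; t] k < nth 0 [:: 0; s; t] k.+1.
  by case: k => [|[|]].
have fP k l : [set (fun x : 'I_1 -> 'I_d -> R => x ord0 i) | i in setT] (f k l).
  by rewrite /f; case: ifP => _; [exists i|exists j].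
have mD k l : measurable (D k l) by rewrite /D; case: ifP.
move=> /(_ incr fP mD); cbv zeta.
rewrite big_ord_recl big_ord1 /=.
set E := [set w | _]; set E1 := [set w | _]; set E2 := [set w | _] => EI.
have E1E : E1 = X @^-1` A.
  apply/seteqP; split=> w; rewrite /E1 /=; first by move=> /(_ ord0).
  by move=> h k; exact: h.
have E2E : E2 = Y @^-1` A'.
  apply/seteqP; split=> w; rewrite /E2 /=; first by move=> /(_ ord0).
  by move=> h k; exact: h.
have EE : E = E1 `&` E2.
  apply/seteqP; split=> w; rewrite /E /=.
    by move=> h; split; [exact: (h ord0)|exact: (h (lift ord0 ord0))].
  move=> [h1 h2] k; have [->|[->]] : k = ord0 \/ k = lift ord0 ord0.
  - by case: k => -[|[|//]] kP; [left|right]; apply: val_inj.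
  - exact: h1.
  - exact: h2.
rewrite -E1E -E2E -EE -[LHS]fineK ?fin_num_measure//; last first.
  by rewrite EE; apply: measurableI; rewrite ?E1E ?E2E.
by rewrite EI EFinM !fineK ?fin_num_measure// ?E1E ?E2E.
Qed.

Lemma wiener_cov_incr : exists Sig : 'M[R]_d, forall s t i j, 0 <= s <= t ->
  has_exp P (fun w => (b t w ord0 i - b s w ord0 i) *
                      (b t w ord0 j - b s w ord0 j)) ((t - s) * Sig i j).
Proof.
case: (bW) => _ _ _ _ [Sig bS]; exists Sig => s t i j /andP[s0 st].
have t0 := le_trans s0 st.
apply: has_exp_integral; last by apply: (bS _ _ _ _ _).2; rewrite s0.
by apply: measurable_funM; exact: wiener_measurable_incr.
Qed.

(** For [s <= t], write [b t] as [b s] plus an increment: the first term contributes [s * Sig i j],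
    and the second is orthogonal to [b s]. *)
Lemma wiener_cov : exists Sig : 'M[R]_d, forall s t i j, 0 <= s -> 0 <= t ->
  has_exp P (fun w => b s w ord0 i * b t w ord0 j) (Order.min s t * Sig i j).
Proof.
have [Sig covI] := wiener_cov_incr; case: (bW) => b0 _ _ _ _; exists Sig.
have cov_diag t i j : 0 <= t ->
    has_exp P (fun w => b t w ord0 i * b t w ord0 j) (t * Sig i j).
  move=> t0; have := covI 0 t i j; rewrite lexx t0 subr0 => /(_ isT).
  by apply: has_exp_ae => //; apply: filterS b0 => w ->; rewrite !mxE !subr0.
(* Symmetry, read off at time 1, serves the case [t <= s], where exchanging the times also exchanges
   the indices. *)
have SigC i j : Sig i j = Sig j i.
  have := cov_diag 1 i j ler01; have := cov_diag 1 j i ler01.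
  rewrite (_ : (fun w => b 1 w ord0 j * _) = fun w => b 1 w ord0 i * b 1 w ord0 j).
    by move=> h1 /(has_exp_eq h1); rewrite !mul1r.
  by apply/funext => w; rewrite mulrC.
have ortho s t i j : 0 <= s -> s < t ->
    has_exp P (fun w => b s w ord0 i * (b t w ord0 j - b s w ord0 j)) 0.
  move=> s0 st; have t0 := le_trans s0 (ltW st).
  (* At [s = 0] the times 0, [s], [t] are not strictly increasing, but the product vanishes almost
     surely. *)
  move: s0; rewrite le_eqVlt => /predU1P[<-|s0].
    apply: has_exp_ae (has_exp0 P) => //.
    by apply: filterS b0 => w ->; rewrite !mxE mul0r.
  pose X w := b s w ord0 i - b 0 w ord0 i.
  pose Y w := b t w ord0 j - b s w ord0 j.
  have mX : measurable_fun setT X by exact: wiener_measurable_incr (ltW s0).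
  have EY : has_exp P Y 0 by exact: wiener_exp_incr (ltW s0) t0.
  have s0' := ltW s0; have st' := ltW st.
  have EXX : has_exp P (fun w => X w * X w) ((s - 0) * Sig i i).
    by apply: covI; rewrite lexx.
  have EYY : has_exp P (fun w => Y w * Y w) ((t - s) * Sig j j).
    by apply: covI; rewrite s0'.
  (* The second moments of the increments make the product integrable; independence then makes its
     expectation zero. *)
  have [q EXY] := has_expM_square mX (has_exp_measurable EY) EXX EYY.
  have q0 : q = 0.
    apply: (indep_has_expM mX EY EXY) => A A' mA mA'.
    exact: wiener_independent_incr.
  move: EXY; rewrite q0; apply: has_exp_ae => //.
  by apply: filterS b0 => w b0w; rewrite /X b0w !mxE subr0.
have cov_le s t i j : 0 <= s -> s <= t ->
    has_exp P (fun w => b s w ord0 i * b t w ord0 j) (s * Sig i j).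
  move=> s0; rewrite le_eqVlt => /predU1P[<-|st]; first exact: cov_diag.
  have := has_expD (cov_diag s i j s0) (ortho s t i j s0 st).
  rewrite addr0; congr has_exp; apply/funext => w.
  by rewrite -mulrDr addrC subrK.
move=> s t i j s0 t0; have [st|/ltW ts] := leP s t; first exact: cov_le.
rewrite SigC (_ : (fun w => _) = fun w => b t w ord0 j * b s w ord0 i).
  exact: cov_le.
by apply/funext => w; rewrite mulrC.
Qed.

End Wiener.

(** * Fuzzy Brownian motions *)

Section FuzzyBrownianMotion.
Context {dT : measure_display} {T : measurableType dT} {R : realType} {d : nat}.
Variables (P : probability T R) (B : R -> T -> 'rV[R]_d -> R).
Hypothesis Pc : complete_prob P.

(** * From a fuzzy Brownian motion to a Wiener process *)

Section Singletons.
Hypothesis BF : forall t w, 0 <= t -> fuzzy_kc (B t w).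
Hypothesis BM : fuzzy_BM P B.

Let b t w : 'rV[R]_d := \row_i sfun (B t w) 0 (axis i).

Let ev i (f : R -> 'rV[R]_d -> R) : R := f 0 (axis i).

Let Cbar_dual_ev i : Cbar_dual (ev i).
Proof. by apply: Cbar_dual_eval; [rewrite lexx ler01|exact: sphere_axis]. Qed.

Lemma fuzzy_BM_measurable t (L : (R -> 'rV[R]_d -> R) -> R) : 0 <= t ->
  Cbar_dual L -> measurable_fun setT (fun w => L (sfun (B t w))).
Proof.
case: BM => _ BN _ _ _ t0 LC.
have [+ _] := BN 1%N 1%N (fun=> L) (fun=> t) (fun _ _ => 1) (fun=> LC) (fun=> t0).
by apply: eq_measurable_fun => w _; rewrite !big_ord1 mul1r.
Qed.

Lemma fuzzy_BM_exp t (L : (R -> 'rV[R]_d -> R) -> R) : 0 <= t ->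
  Cbar_dual L -> has_exp P (fun w => L (sfun (B t w))) 0.
Proof.
case: (BM) => _ _ BE _ _ t0 LC.
by apply: has_exp_integral; [exact: fuzzy_BM_measurable|exact: BE].
Qed.

Lemma fuzzy_BM_singleton t : 0 <= t -> {ae P, forall w, B t w = ind1 (b t w)}.
Proof.
move=> t0.
have width0 i : {ae P, forall w,
    sfun (B t w) 0 (axis i) + sfun (B t w) 0 (- axis i) = 0}.
  apply: has_exp_ge0_eq0 => [w|]; first exact: sfun0_width_ge0 (BF w t0) _.
  rewrite -[X in has_exp _ _ X](addr0 0); apply: has_expD.
    exact: fuzzy_BM_exp (Cbar_dual_ev i).
  apply: (@fuzzy_BM_exp t (fun f => f 0 (- axis i))) => //.
  apply: Cbar_dual_eval; first by rewrite lexx ler01.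
  exact/sphereN/sphere_axis.
suff : {ae P, forall w i,
    sfun (B t w) 0 (axis i) + sfun (B t w) 0 (- axis i) = 0}.
  by apply: filterS => w; exact: fuzzy_zero_width (BF w t0).
(* There are finitely many axes, so the exceptional null sets have a null union. *)
exact: filter_forall.
Qed.

Lemma fuzzy_BM_wiener : wiener P b.
Proof.
case: (BM) => B0 BN BE BI [Q BQ].
have bN (m : nat) (t : 'I_m -> R) (c : 'I_m -> 'I_d -> R) :
    (forall j, 0 <= t j) ->
    normal_rv P (fun w => \sum_(j < m) \sum_(i < d) c j i * b (t j) w ord0 i).
  move=> t0.
  have := BN d m ev t (fun i j => c j i) Cbar_dual_ev t0.
  congr normal_rv; apply/funext => w; rewrite exchange_big /=.
  by apply: eq_bigr => j _; apply: eq_bigr => i _; rewrite mxE.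
split => //.
- apply: filterS B0 => w B0w; apply/rowP => i.
  by rewrite !mxE B0w sfun_ind1 ?lexx ?ler01// dotv_axis mxE.
- by move=> t i t0; rewrite -[RHS](BE t _ t0 (Cbar_dual_ev i)); apply: eq_integral => w _;
    rewrite mxE.
- move=> n t m f A t0 tlt fP mA E.
  (* Choice recovers the coordinate index behind each test functional, which is then replaced by the
     evaluation [ev] at that axis. *)
  pose j k i := projT1 (cid2 (fP k i)).
  have fE k i : f k i = fun x => x ord0 (j k i).
    by rewrite /j; case: cid2.
  have -> : E = fun k => [set w | forall i : 'I_m, A k i
      (sfun (B (t k.+1) w) 0 (axis (j k i)) - sfun (B (t k) w) 0 (axis (j k i)))].
    apply/funext => k; apply/seteqP; split=> w h i; have := h i;
      by rewrite fE /= !fctE !mxE.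
  exact: (BI n t m (fun k i => ev (j k i)) A t0 tlt).
- exists (\matrix_(i, j) Q (ev i) (ev j)).
  move=> s t i j /andP[s0 st]; have t0 := le_trans s0 st; split.
    (* The increment is a combination of two times, with coefficient 1 at [t] and -1 at [s], on
       coordinate [i] only. *)
    have := bN 2%N (fun k => if k == ord0 then t else s)
      (fun k l => if l == i then if k == ord0 then 1 else -1 else 0).
    rewrite (_ : (fun w => _) = fun w => b t w ord0 i - b s w ord0 i).
      by apply=> k; case: ifP.
    apply/funext => w; rewrite big_ord_recl big_ord1 /=.
    rewrite (bigD1 i)//= big1 => [|k /negbTE ->]; last by rewrite mul0r.
    rewrite (bigD1 i)//= big1 => [|k /negbTE ->]; last by rewrite mul0r.
    by rewrite eqxx !addr0 mul1r mulN1r.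
  have cov u v : 0 <= u -> 0 <= v -> has_exp P
      (fun w => b u w ord0 i * b v w ord0 j) (Order.min u v * Q (ev i) (ev j)).
    move=> u0 v0; rewrite (_ : (fun w => _) =
        fun w => ev i (sfun (B u w)) * ev j (sfun (B v w))); last first.
      by apply/funext => w; rewrite !mxE.
    apply: has_exp_integral; last by apply: BQ.
    by apply: measurable_funM; exact: fuzzy_BM_measurable.
  (* Expanding the product of increments gives the factor [t - s - s + s], since the minimum of the
     two times is [s] in all terms but the first. *)
  have := has_expD (has_expD (cov t t t0 t0) (has_expZ (-1) (cov t s t0 s0)))
                   (has_expD (has_expZ (-1) (cov s t s0 t0)) (cov s s s0 s0)).
  rewrite !minxx (min_r st) (min_l st) => -[_ E2].
  rewrite mxE (_ : (t - s) * _ = t * Q (ev i) (ev j) + -1 * (s * Q (ev i) (ev j)) +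
    (-1 * (s * Q (ev i) (ev j)) + s * Q (ev i) (ev j))); last by ring.
  by rewrite -E2; apply: eq_integral => w _; congr EFin; ring.
Qed.


End Singletons.

(** * From a Wiener process to a fuzzy Brownian motion *)

Section WienerSingletons.
Variable b : R -> T -> 'rV[R]_d.
Hypotheses (bW : wiener P b)
  (Bb : forall t, 0 <= t -> {ae P, forall w, B t w = ind1 (b t w)}).

Let lin (L : (R -> 'rV[R]_d -> R) -> R) i := L (fun _ x => dotv x (axis i)).

Lemma dual_ae t L : 0 <= t -> Cbar_dual L ->
  {ae P, forall w, \sum_(i < d) lin L i * b t w ord0 i = L (sfun (B t w))}.
Proof.
by move=> t0 LC; apply: filterS (Bb t0) => w ->; rewrite Cbar_dual_sfun_ind1.
Qed.

Lemma singleton_indep_increments : indep_increments P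
  (fun f g : R -> 'rV[R]_d -> R => fun al x => f al x - g al x)
  (@Cbar_dual R d) (fun t w => sfun (B t w)).
Proof.
case: (bW) => _ _ _ bI _ n t m f A t0 tlt fC mA E.
have t_ge0 k : (k <= n)%N -> 0 <= t k.
  by elim: k => // k IHk kn; apply: le_trans (IHk (ltnW kn)) (ltW (tlt k kn)).
pose X k i w := b (t k.+1) w ord0 i - b (t k) w ord0 i.
have mX (k : 'I_n) i : measurable_fun setT (X k i).
  by apply: (wiener_measurable_incr bW); apply: t_ge0; rewrite // ltnW.
(* Rectangles in the coordinates of the [k]-th increment of [b]: a pi-system on which [wiener]
   states independence directly. *)
pose G (k : 'I_n) : set (set T) := [set S | exists2 C : 'I_d -> set R,
  (forall i, measurable (C i)) & S = [set w | forall i, C i (X k i w)]].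
(* [E'] agrees with [E] almost surely, but is stated through linear combinations of the coordinates
   of [X k], hence lies in [<<s G k >>]. *)
pose E' (k : 'I_n) :=
  [set w | forall i : 'I_m, A k i (\sum_(j < d) lin (f k i) j * X k j w)].
have GX k i (C : set R) : measurable C -> G k (X k i @^-1` C).
  move=> mC; exists (fun j => if j == i then C else setT).
    by move=> j; case: ifP.
  apply/seteqP; split=> w /=; first by move=> Cw j; case: eqP => [->|].
  by move=> /(_ i); rewrite eqxx.
have GE' k : <<s G k >> (E' k).
  (* [S] is [T] with the sigma-algebra generated by [G k], so measurability on [S] is membership of
     preimages in [<<s G k >>]. *)
  pose S := g_sigma_algebraType (G k).
  have mXS j : measurable_fun [set: S] (X k j : S -> R).
    by move=> _ C mC; rewrite setTI; apply: sub_sigma_algebra; exact: GX.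
  have mlin i : measurable_fun [set: S]
      (fun w : S => \sum_(j < d) lin (f k i) j * X k j w).
    apply: measurable_sum => j.
    by apply: measurable_funM => //; exact: measurable_cst.
  rewrite (_ : E' k = \bigcap_(i in setT)
      ((fun w : S => \sum_(j < d) lin (f k i) j * X k j w) @^-1` A k i)).
    apply: (@fin_bigcap_measurable _ S) => // i _.
    by rewrite -[X in measurable X]setTI; exact: mlin.
  by apply/seteqP; split=> w h i; [move=> _; exact: h|exact: (h i I)].
have Gm k : G k `<=` measurable.
  move=> _ [C mC ->]; rewrite (_ : [set w | _] = \bigcap_(i in setT) (X k i @^-1` C i)).
    apply: fin_bigcap_measurable => // i _.
    by rewrite -[X in measurable X]setTI; exact: mX.
  by apply/seteqP; split=> w h i; [move=> _; exact: h|exact: (h i I)].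
have mE' k : measurable (E' k).
  exact: (smallest_sub (@sigma_algebra_measurable _ T) (Gm k)) (GE' k).
have EE' : {ae P, forall w (k : 'I_n), E' k w <-> E k w}.
  apply: filter_forall => k.
  have t1 : 0 <= t k by apply: t_ge0; rewrite ltnW.
  have t2 : 0 <= t k.+1 by exact: t_ge0.
  apply: filterS2 (Bb t1) (Bb t2) => w B1 B2; rewrite /E /E' /=.
  have eqf i : f k i (fun al x => sfun (B (t k.+1) w) al x - sfun (B (t k) w) al x) =
      \sum_(j < d) lin (f k i) j * X k j w.
    rewrite B1 B2 Cbar_dual_sfun_ind1B//.
    by apply: eq_bigr => j _; rewrite !mxE.
  by split=> h i; have := h i; rewrite eqf.
have -> : P [set w | forall k, E k w] = P [set w | forall k, E' k w].
  apply: (ae_set_measurable Pc _ _).2.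
    rewrite (_ : [set w | _] = \bigcap_(k in setT) E' k).
      by apply: fin_bigcap_measurable => // k _; exact: mE'.
    by apply/seteqP; split=> w h k; [move=> _; exact: h|exact: (h k I)].
  by apply: filterS EE' => w EE' /=; split=> h k; apply/EE'.
transitivity (\prod_(k < n) fine (P (E' k))); last first.
  apply: eq_bigr => k _; congr fine; apply/esym/(ae_set_measurable Pc _ _).2 => //.
  by apply: filterS EE' => w.
apply: (indep_sigma (G := G)) => //.
- by move=> k; exists (fun=> setT) => //; apply/seteqP; split.
- move=> k _ _ [C mC ->] [C' mC' ->]; exists (fun i => C i `&` C' i).
    by move=> i; exact: measurableI.
  apply/seteqP; split=> w /=; first by move=> [h h'] i; split.
  by move=> h; split=> i; case: (h i).
- move=> F FG; pose C k := projT1 (cid2 (FG k)).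
  have mC k i : measurable (C k i) by rewrite /C; case: cid2.
  have FE : F = fun k => [set w | forall i, C k i (X k i w)].
    by apply/funext => k; rewrite /C; case: cid2.
  (* One test functional per coordinate turns the events of [wiener] into exactly these
     rectangles. *)
  rewrite FE; apply: (bI n t d (fun _ i x => x ord0 i) C) => //.
Qed.

Lemma singleton_fuzzy_BM : fuzzy_BM P B.
Proof.
case: (bW) => b0 bN bE bI _; have [Sig covb] := wiener_cov Pc bW.
have exp_dual t L : 0 <= t -> Cbar_dual L -> has_exp P (fun w => L (sfun (B t w))) 0.
  move=> t0 LC; apply: has_exp_ae (dual_ae t0 LC) _ => //.
  have := has_exp_sum (index_enum 'I_d)
    (fun i => has_expZ (lin L i) (wiener_exp bW i t0)).
  by rewrite big1// => i _; rewrite mulr0.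
split.
- by apply: filterS2 (Bb (lexx 0)) b0 => w -> ->.
- move=> n m L t c LC t0.
  have LB : {ae P, forall w (j : 'I_m) (i : 'I_n),
      \sum_(k < d) lin (L i) k * b (t j) w ord0 k = L i (sfun (B (t j) w))}.
    by apply: filter_forall => j; apply: filter_forall => i; exact: dual_ae.
  (* Each [L i] contributes its coefficients [lin (L i) k]; collecting the terms in coordinate [k]
     at time [t j] gives the weights below. *)
  apply: (normal_rv_ae Pc _
    (bN m t (fun j k => \sum_(i < n) c i j * lin (L i) k) t0)).
  apply: filterS LB => w LB; rewrite [RHS]exchange_big /=.
  apply: eq_bigr => j _.
  under eq_bigr do rewrite mulr_suml.
  rewrite exchange_big /=; apply: eq_bigr => i _.
  by rewrite -LB mulr_sumr; apply: eq_bigr => k _; rewrite mulrA.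
- by move=> t L t0 LC; rewrite (proj2 (exp_dual t L t0 LC)).
- exact: singleton_indep_increments.
(* The covariance is the form [Sig] applied to the coefficient vectors of the two functionals. *)
- exists (fun L1 L2 => \sum_(i < d) \sum_(j < d) lin L1 i * lin L2 j * Sig i j).
  move=> L1 L2 t1 t2 LC1 LC2 t10 t20.
  have EL : has_exp P (fun w => L1 (sfun (B t1 w)) * L2 (sfun (B t2 w)))
      (\sum_(i < d) \sum_(j < d)
        (lin L1 i * lin L2 j) * (Order.min t1 t2 * Sig i j)).
    have := has_exp_sum (index_enum 'I_d) (fun i => has_exp_sum (index_enum 'I_d)
      (fun j => has_expZ (lin L1 i * lin L2 j) (covb t1 t2 i j t10 t20))).
    apply: has_exp_ae => //.
    apply: filterS2 (dual_ae t10 LC1) (dual_ae t20 LC2) => w <- <-.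
    rewrite mulr_suml; apply: eq_bigr => i _; rewrite mulr_sumr.
    by apply: eq_bigr => j _; rewrite mulrACA.
  rewrite (proj2 EL) mulr_sumr; congr EFin; apply: eq_bigr => i _.
  by rewrite mulr_sumr; apply: eq_bigr => j _; rewrite mulrCA.
Qed.

End WienerSingletons.

End FuzzyBrownianMotion.

Theorem theorem1 (dT : measure_display) (T : measurableType dT) (R : realType)
  (P : probability T R) (F : R -> set (set T)) (d : nat)
  (B : R -> T -> 'rV[R]_d -> R) :
  complete_prob P ->
  usual_filtration P F ->
  (forall t w, 0 <= t -> fuzzy_kc (B t w)) ->
  adapted_fuzzy F B ->
  (fuzzy_BM P B <->
   exists b : R -> T -> 'rV[R]_d,
     wiener P b /\ forall t, 0 <= t -> {ae P, forall w, B t w = ind1 (b t w)}).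
Proof.
move=> Pc _ BF _; split=> [BM|[b [bW Bb]]]; last exact: singleton_fuzzy_BM bW Bb.
exists (fun t w => \row_i sfun (B t w) 0 (axis i)); split.
  exact: fuzzy_BM_wiener.
by move=> t t0; exact: fuzzy_BM_singleton.
Qed.
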